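(* Let $k\ge1$ and let $\mathcal{E}$ be a finite ensemble of distinct unitary operators, taken with uniform probability, on a system of $n$ qubits, with $k$th frame potential $F^{(k)}_{\mathcal{E}}$. Then the circuit complexity of generating $\mathcal{E}$ is lower bounded by $$\mathcal{C}(\mathcal{E})\ \ge\ \frac{2kn\log(2)-\log F^{(k)}_{\mathcal{E}}}{\log(\mathrm{choices})},$$ where $\mathrm{choices}\ge 2$ is the number of choices available at each step of building a circuit.
   Context: The $k$th frame potential is $F^{(k)}_{\mathcal{E}}=\frac{1}{|\mathcal{E}|^2}\sum_{U,V\in\mathcal{E}}|\mathrm{tr}\{U^\dagger V\}|^{2k}$. Circuits are built step by step; at each step one selects one of finitely many allowed elementary unitaries on the $n$ qubits and applies it, and $\mathrm{choices}$ denotes the number of options per step (e.g. with a gate set of $g$ $q$-qubit gates, each of which may be applied to any $q$ of the $n$ qubits, $\mathrm{choices}=g\binom nq$). The circuit complexity $\mathcal{C}(\mathcal{E})$ is the smallest number of steps $T$ such that every unitary in $\mathcal{E}$ is implemented by some $T$-step circuit ($\infty$ if there is none). *)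

(* Defs.v *)
From mathcomp Require Export all_boot all_order all_algebra.
From mathcomp Require Export finmap complex.
From mathcomp Require Export all_classical all_reals all_analysis.

Set Implicit Arguments.
Unset Strict Implicit.
Unset Printing Implicit Defensive.

Import Order.TTheory GRing.Theory Num.Theory.

Local Open Scope ring_scope.
Local Open Scope complex_scope.
Local Open Scope sesquilinear_scope.

Notation operator R n := 'M[R[i]]_(2 ^ n).

(* [complex.Re `|z|] is the modulus of [z : R[i]] as an element of [R]: the
   norm of [R[i]] takes its values in [R[i]] itself. *)
Definition frame_potential (R : realType) (n k : nat)
    (E : {fset operator R n}) : R :=
  (#|` E|%:R ^+ 2)^-1 *
  \sum_(U <- E) \sum_(V <- E) complex.Re `|\tr (U ^t* *m V)| ^+ (2 * k).

(* The option selected first is the head of [s]; it acts first, hence is the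
   rightmost factor. The empty circuit is the identity. *)
Definition run (R : realType) (n c : nat) (gate : 'I_c -> operator R n)
    (s : seq 'I_c) : operator R n :=
  foldl (fun U i => gate i *m U) 1%:M s.

(* The circuits have exactly [T] steps: at every step one of the [c] options
   has to be selected, so idling is possible only if the identity is among
   them. *)
Definition generated_in (R : realType) (n c : nat)
    (gate : 'I_c -> operator R n) (E : {fset operator R n}) (T : nat) : bool :=
  all (fun U => [exists s : T.-tuple 'I_c, run gate s == U]) E.

Definition circuit_complexity (R : realType) (n c : nat)
    (gate : 'I_c -> operator R n) (E : {fset operator R n}) : \bar R :=
  match pselect (exists T, generated_in gate E T) with
  | left ex => ((ex_minn ex)%:R : R)%:E
  | right _ => +oo%E
  end.

(* Main.v *)
(** Keeping only the diagonal terms [U = V], where the trace of [U^t* *m U] is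
    [2 ^ n], shows that the frame potential is at least [2 ^ (2kn) / |E|]: hence
    the numerator of the bound is at most [ln |E|]. On the other hand at most
    [choices ^ T] unitaries can be reached by circuits with [T] steps. *)
Require Import Defs.
From mathcomp Require Import ring.
Import Order.TTheory GRing.Theory Num.Theory.
Local Open Scope ring_scope.
Local Open Scope complex_scope.
Local Open Scope sesquilinear_scope.

Lemma Re_norm_ge0 (R : rcfType) (z : R[i]) : 0 <= complex.Re `|z|.
Proof. by have := normr_ge0 z; rewrite lecE => /andP[]. Qed.

Lemma Re_norm_nat (R : rcfType) (m : nat) : complex.Re `|m%:R : R[i]| = m%:R.
Proof. by rewrite normr_nat -(rmorph_nat (real_complex R)). Qed.

Lemma mxtrace_unitary_adj (C : numClosedFieldType) (n : nat) (U : 'M[C]_n) :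
  U \is unitarymx -> \tr (U ^t* *m U) = n%:R.
Proof. by move=> /unitarymxP UU; rewrite mxtrace_mulC UU mxtrace1. Qed.

Lemma le_frame_potential (R : realType) (n k : nat) (E : {fset operator R n}) :
  (forall U : operator R n, U \in E -> U \is unitarymx) ->
  2 ^+ (2 * k * n) / #|` E|%:R <= frame_potential k E.
Proof.
move=> Eunitary; have [->|E0] := eqVneq E fset0.
  (* For the empty ensemble both sides are [0], by the convention [0^-1 = 0]. *)
  by rewrite /frame_potential cardfs0 expr0n !invr0 mulr0 mul0r.
have cE : 0 < #|` E|%:R :> R by rewrite ltr0n cardfs_gt0.
(* Spreading the left side as a constant over [U] in [E] reduces the claim to a bound on the inner
   sum for each fixed [U]. *)
have -> : 2 ^+ (2 * k * n) / #|` E|%:R =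
    (#|` E|%:R ^+ 2)^-1 * \sum_(U <- E) 2 ^+ (2 * k * n) :> R.
  rewrite big_const_seq count_predT iter_addr_0 -[X in _ = _ * X]mulr_natr.
  by field; rewrite gt_eqF.
rewrite /frame_potential ler_pM2l ?invr_gt0 ?exprn_gt0//.
rewrite big_seq [leRHS]big_seq; apply: ler_sum => U UE.
rewrite (big_rem U UE) mxtrace_unitary_adj ?Eunitary// Re_norm_nat.
rewrite natrX -exprM [(n * _)%N]mulnC lerDl.
by apply: sumr_ge0 => V _; rewrite exprn_ge0 ?Re_norm_ge0.
Qed.

(** Distinct unitaries need distinct circuits. The list of outcomes over all [T]-tuples may contain
    repetitions, but only its length [c ^ T] matters. *)
Lemma card_generated_in (R : realType) (n c T : nat)
    (gate : 'I_c -> operator R n) (E : {fset operator R n}) :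
  generated_in gate E T -> (#|` E| <= c ^ T)%N.
Proof.
move=> /allP gen.
have -> : (c ^ T)%N = size [seq run gate s | s : T.-tuple 'I_c].
  by rewrite size_map -cardE card_tuple card_ord.
apply: uniq_leq_size (fset_uniq E) _ => U /gen /existsP[s /eqP <-].
by apply: map_f; rewrite mem_enum.
Qed.

Theorem theorem6 (R : realType) (n k choices : nat)
    (gate : 'I_choices -> operator R n) (E : {fset operator R n}) :
  (1 <= k)%N ->
  (2 <= choices)%N ->
  (forall i : 'I_choices, gate i \is unitarymx) ->
  E != fset0 ->
  (forall U : operator R n, U \in E -> U \is unitarymx) ->
  (((2 * k%:R * n%:R * ln 2 - ln (frame_potential k E))
      / ln choices%:R)%:E
    <= circuit_complexity gate E)%E.
Proof.
move=> _ choices2 _ E0 Eunitary; rewrite /circuit_complexity.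
case: pselect => [ex|_]; last by rewrite leey.
case: ex_minnP => T gen _; rewrite lee_fin.
have cE : 0 < #|` E|%:R :> R by rewrite ltr0n cardfs_gt0.
have c0 : 0 < choices%:R :> R by rewrite ltr0n (ltnW choices2).
rewrite ler_pdivrMr ?ln_gt0 ?ltr1n//.
(* The quantity [ln #|E|] separates the frame potential bound from the circuit count. *)
apply: (@le_trans _ _ (ln #|` E|%:R)).
  have pow_gt0 : 0 < 2 ^+ (2 * k * n) :> R by rewrite exprn_gt0.
  have FE := le_frame_potential R n k E Eunitary.
  (* Comparing logarithms requires a positive frame potential; this is where [E] being nonempty
     enters. *)
  have F0 := lt_le_trans (divr_gt0 pow_gt0 cE) FE.
  have : ln (2 ^+ (2 * k * n) / #|` E|%:R) <= ln (frame_potential k E).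
    by rewrite ler_ln ?posrE ?divr_gt0.
  rewrite ln_div ?posrE// lnXn//.
  by rewrite -[ln 2 *+ _]mulr_natl !natrM lerBlDr lerBlDl.
rewrite mulr_natl -lnXn// ler_ln ?posrE ?exprn_gt0//.
by rewrite -natrX ler_nat; apply: card_generated_in gen.
Qed.
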